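(* Let $f:\mathbb{R}^n\to\mathbb{R}^n$ and $g:\mathbb{R}^n\to\mathbb{R}^{n\times m}$ define the control-affine system $\dot{x}=f(x)+g(x)u$, where $u$ takes values in a nonempty compact convex polytope $U\subset\mathbb{R}^m$, and let $\mathcal{V}(U)$ denote the set of vertices of $U$. Let $h:\mathbb{R}^n\to\mathbb{R}$ be continuously differentiable, let $C=\{x\in\mathbb{R}^n: h(x)\ge 0\}$, let $\mathcal{D}\supseteq C$ be a box, and let $\alpha>0$. Define $$B_h(x):=\max_{u\in\mathcal{V}(U)}\Bigl[\nabla h(x)^\top f(x)+\bigl(\nabla h(x)^\top g(x)\bigr)u\Bigr]+\alpha h(x).$$ Then $h$ is a control barrier function on $\mathcal{D}$ (with constant $\alpha$) if and only if, for all $x\in\mathcal{D}$, $$B_h(x)\ge 0\ \vee\ h(x)<0.$$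
   Context: A box is a set of the form $\prod_{i=1}^n[\ell_i,u_i]$. For fixed $\alpha>0$, a continuously differentiable function $h$ is called a control barrier function on $\mathcal{D}$ for the system $\dot{x}=f(x)+g(x)u$, $u\in U$, if $$\sup_{u\in U}\bigl[\nabla h(x)^\top f(x)+(\nabla h(x)^\top g(x))u\bigr]\ge-\alpha h(x)\quad\text{for all }x\in\mathcal{D}\text{ with }h(x)\ge 0.$$ *)

(* Defs.v *)
From HB Require Import structures.
From mathcomp Require Import all_boot all_order all_algebra.
From mathcomp Require Import all_classical all_reals all_analysis.

Set Implicit Arguments.
Unset Strict Implicit.
Unset Printing Implicit Defensive.

Import Order.TTheory GRing.Theory Num.Theory.
Import numFieldNormedType.Exports.

Local Open Scope classical_set_scope.
Local Open Scope ring_scope.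

Definition is_box (R : realType) (n : nat) (D : set 'cV[R]_n) : Prop :=
  exists l u : 'cV[R]_n,
    D = [set x | forall i, l i 0 <= x i 0 <= u i 0].

Definition convex_hull (R : realType) (m k : nat) (p : 'I_k -> 'cV[R]_m) :
    set 'cV[R]_m :=
  [set v | exists w : 'I_k -> R,
    [/\ forall i, 0 <= w i, \sum_(i < k) w i = 1 &
        v = \sum_(i < k) w i *: p i]].

Definition is_polytope (R : realType) (m : nat) (U : set 'cV[R]_m) : Prop :=
  exists (k : nat) (p : 'I_k -> 'cV[R]_m), U = convex_hull p.

(* The part of U on which an inequality c^T u <= b, valid on U, is tight. *)
Definition is_face (R : realType) (m : nat) (U F : set 'cV[R]_m) : Prop :=
  exists (c : 'cV[R]_m) (b : R),
    (forall u, U u -> (c^T *m u) 0 0 <= b) /\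
    F = U `&` [set u | (c^T *m u) 0 0 = b].

(* The zero-dimensional faces. *)
Definition vertices (R : realType) (m : nat) (U : set 'cV[R]_m) :
    set 'cV[R]_m :=
  [set v | is_face U [set v]].

(* The greatest element of A; the value is 0 if there is none. *)
Definition set_max (R : realType) (A : set R) : R :=
  xget 0 [set a | A a /\ ubound A a].

Definition gradient (R : realType) (n : nat) (h : 'cV[R]_n -> R)
    (x : 'cV[R]_n) : 'cV[R]_n :=
  \col_i 'D_(delta_mx i 0) h x.

Definition continuously_differentiable (R : realType) (n : nat)
    (h : 'cV[R]_n -> R) : Prop :=
  (forall x, differentiable h x) /\ continuous (gradient h).

(* The derivative of h along the vector field x |-> f x + g x u. *)
Definition hdot (R : realType) (n m : nat)
    (f : 'cV[R]_n -> 'cV[R]_n) (g : 'cV[R]_n -> 'M[R]_(n, m))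
    (h : 'cV[R]_n -> R) (x : 'cV[R]_n) (u : 'cV[R]_m) : R :=
  ((gradient h x)^T *m f x + ((gradient h x)^T *m g x) *m u) 0 0.

(* The supremum is taken in the extended reals, so that it is meaningful for
   every input set U, whether or not it is bounded or empty. *)
Definition control_barrier_function (R : realType) (n m : nat)
    (f : 'cV[R]_n -> 'cV[R]_n) (g : 'cV[R]_n -> 'M[R]_(n, m))
    (U : set 'cV[R]_m) (alpha : R) (D : set 'cV[R]_n)
    (h : 'cV[R]_n -> R) : Prop :=
  continuously_differentiable h /\
  forall x, D x -> 0 <= h x ->
    ((- (alpha * h x))%:E <= ereal_sup [set (hdot f g h x u)%:E | u in U])%E.

Definition barrier_fun (R : realType) (n m : nat)
    (f : 'cV[R]_n -> 'cV[R]_n) (g : 'cV[R]_n -> 'M[R]_(n, m))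
    (U : set 'cV[R]_m) (alpha : R) (h : 'cV[R]_n -> R) (x : 'cV[R]_n) : R :=
  set_max [set hdot f g h x u | u in vertices U] + alpha * h x.

(* Main.v *)
(* A linear functional c on conv(p_1, ..., p_k) is maximal at some p_i. Among
   the maximizing p_i choose p_j of largest Euclidean norm: by strict convexity
   of the norm, the functional <p_j, _> separates p_j from the other maximizing
   points, so t c + <p_j, _> for t large is maximal on the polytope at p_j only,
   and p_j is a vertex. Hence the supremum of an affine function over the
   polytope is its maximum over the vertices. *)
Require Import Defs.
From mathcomp Require Import all_boot all_order all_algebra.
From mathcomp Require Import all_classical all_reals all_analysis.
From mathcomp Require Import lra.
Import Order.TTheory GRing.Theory Num.Theory.
Import numFieldNormedType.Exports.
Local Open Scope classical_set_scope.
Local Open Scope ring_scope.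

Definition dot {R : realType} {m : nat} (a b : 'cV[R]_m) : R :=
  (a^T *m b) 0 0.

Section Dot.
Context {R : realType} {m : nat}.
Implicit Types a b c : 'cV[R]_m.

Lemma dotE a b : dot a b = \sum_i a i 0 * b i 0.
Proof. by rewrite /dot mxE; apply: eq_bigr => i _; rewrite mxE. Qed.

Lemma dotC a b : dot a b = dot b a.
Proof. by rewrite !dotE; apply: eq_bigr => i _; rewrite mulrC. Qed.

Lemma dotDl a b c : dot (a + b) c = dot a c + dot b c.
Proof. by rewrite /dot linearD mulmxDl mxE. Qed.

Lemma dotZl t a b : dot (t *: a) b = t * dot a b.
Proof. by rewrite /dot linearZ -scalemxAl mxE. Qed.

Lemma dotBl a b c : dot (a - b) c = dot a c - dot b c.
Proof. by rewrite -scaleN1r dotDl dotZl mulN1r. Qed.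

Lemma dotBr a b c : dot c (a - b) = dot c a - dot c b.
Proof. by rewrite dotC dotBl !(dotC c). Qed.

Lemma dot_sumr k (w : 'I_k -> R) (p : 'I_k -> 'cV[R]_m) c :
  dot c (\sum_i w i *: p i) = \sum_i w i * dot c (p i).
Proof.
rewrite /dot mulmx_sumr summxE; apply: eq_bigr => i _.
by rewrite -scalemxAr mxE.
Qed.

Lemma dot_ge0 a : 0 <= dot a a.
Proof. by rewrite dotE sumr_ge0 // => i _; rewrite -expr2 sqr_ge0. Qed.

Lemma dot_eq0 a : dot a a = 0 -> a = 0.
Proof.
rewrite dotE => /psumr_eq0P a0; apply/colP => i; rewrite mxE.
apply/eqP; rewrite -sqrf_eq0 expr2; apply/eqP; apply: a0 => // j _.
by rewrite -expr2 sqr_ge0.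
Qed.

(** Expanding [0 < dot (b - a) (b - a)] gives [2 * dot a b < dot a a + dot b b], and the right side
    is at most [2 * dot a a]. *)
Lemma dot_lt_of_norm a b : dot b b <= dot a a -> b != a -> dot a b < dot a a.
Proof.
move=> leba neba.
have : 0 < dot (b - a) (b - a).
  rewrite lt_neqAle dot_ge0 andbT eq_sym; apply: contra neba => /eqP/dot_eq0.
  by move/eqP; rewrite subr_eq0.
rewrite dotBl !dotBr (dotC b a) => ?; lra.
Qed.

End Dot.

Section ConvexHull.
Context {R : realType} {m k : nat} (p : 'I_k -> 'cV[R]_m).
Implicit Type c : 'cV[R]_m.

Lemma convex_hull_gen j : convex_hull p (p j).
Proof.
exists (fun i => (i == j)%:R); split.
- by move=> i; rewrite ler0n.
- by rewrite (bigD1 j) //= eqxx big1 ?addr0 // => i /negbTE ->.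
- rewrite (bigD1 j) //= eqxx scale1r big1 ?addr0 // => i /negbTE ->.
  by rewrite scale0r.
Qed.

Lemma dot_convex_hull_le c b :
  (forall i, dot c (p i) <= b) -> forall u, convex_hull p u -> dot c u <= b.
Proof.
move=> cb _ [w [w0 w1 ->]]; rewrite dot_sumr -[b]mul1r -w1 mulr_suml.
by apply: ler_sum => i _; rewrite ler_wpM2l.
Qed.

(** The functional [c] itself exposes the face. At a maximizer, the nonnegative terms
    [w i * (dot c (p j) - dot c (p i))] sum to 0, so all weight sits on copies of [p j]. Points
    rather than indices are compared because generators may repeat. *)
Lemma unique_max_vertex c j :
  (forall i, p i != p j -> dot c (p i) < dot c (p j)) ->
  vertices (convex_hull p) (p j).
Proof.
move=> cj.
have cle i : dot c (p i) <= dot c (p j).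
  by have [->//|/cj/ltW] := eqVneq (p i) (p j).
exists c, (dot c (p j)); split; first exact: dot_convex_hull_le.
apply/seteqP; split => [_ ->|u [[w [w0 w1 ->]]]]/=.
  by split => //; exact: convex_hull_gen.
rewrite -/(dot _ _) dot_sumr => cw.
have sum0 : \sum_i w i * (dot c (p j) - dot c (p i)) = 0.
  under eq_bigr do rewrite mulrBr.
  by rewrite sumrB cw -mulr_suml w1 mul1r subrr.
have term0 i : w i * (dot c (p j) - dot c (p i)) = 0.
  by apply: (psumr_eq0P _ sum0) => // l _; rewrite mulr_ge0 ?subr_ge0.
(* With [p j] written as the sum of [w i *: p j], the two sums agree term by term: either the points
   coincide or the weight vanishes. *)
rewrite -[RHS]scale1r -w1 scaler_suml; apply: eq_bigr => i _.
have [->//|/cj ltij] := eqVneq (p i) (p j).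
move/eqP: (term0 i); rewrite mulf_eq0 subr_eq0 (gt_eqF ltij) orbF => /eqP ->.
by rewrite !scale0r.
Qed.

Lemma convex_hull_vertex_max c : convex_hull p !=set0 ->
  exists2 v, vertices (convex_hull p) v &
    forall u, convex_hull p u -> dot c u <= dot c v.
Proof.
move=> [u0 [w0 [_ w01 _]]].
(* The argmax needs an index to start from; for [k = 0] the weights would sum to 0 instead of 1. *)
have [i0] : exists i0 : 'I_k, True.
  case: k p w0 w01 => [p' w'|k' _ _ _]; last by exists ord0.
  by rewrite big_ord0 => /eqP; rewrite eq_sym oner_eq0.
move=> _.
have [a _ amax] := @arg_maxP _ _ _ i0 xpredT (fun i => dot c (p i)) isT.
have [j /eqP ja jmax] := @arg_maxP _ _ _ a
  (fun i => dot c (p i) == dot c (p a)) (fun i => dot (p i) (p i)) (eqxx _).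
have cle i : dot c (p i) <= dot c (p j) by rewrite ja; exact: amax.
exists (p j); last exact: dot_convex_hull_le.
(* The summands with [c (p i) = c (p j)] are 0, by division by zero. *)
pose q i := `|dot (p j) (p i) - dot (p j) (p j)| / (dot c (p j) - dot c (p i)).
have q0 i : 0 <= q i by rewrite divr_ge0 ?subr_ge0.
(* One [t] must exceed every ratio [q i]; the sum dominates each of them and the summand 1 makes the
   inequality strict. *)
pose t := 1 + \sum_i q i.
apply: (@unique_max_vertex (t *: c + p j)) => i neij.
rewrite !dotDl !dotZl.
(* Ties for [c] are broken by the maximal norm of [p j]; otherwise the gap in [c], scaled by [t],
   must dominate. *)
have [eqij|neqij] := eqVneq (dot c (p i)) (dot c (p j)).
  rewrite eqij ltrD2l dot_lt_of_norm //; apply: jmax.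
  by rewrite eqij ja.
have d0 : 0 < dot c (p j) - dot c (p i) by rewrite subr_gt0 lt_neqAle neqij cle.
have qt : q i < t.
  rewrite /t (bigD1 i) //= addrCA ltrDl ltr_wpDr //.
  exact: sumr_ge0.
(* Clearing the denominator bounds what [p i] can gain under [dot (p j)] by [t] times its loss under
   [c]. *)
move: qt; rewrite /q ltr_pdivrMr // => /(le_lt_trans (ler_norm _)) ?.
lra.
Qed.

End ConvexHull.

Lemma vertices_sub {R : realType} {m : nat} (U : set 'cV[R]_m) :
  vertices U `<=` U.
Proof.
move=> v [c [b [_ vE]]].
by have : [set v] v by []; rewrite vE => -[].
Qed.

Lemma set_max_eq {R : realType} (A : set R) (a : R) :
  A a -> ubound A a -> set_max A = a.
Proof.
move=> Aa ua; rewrite /set_max.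
(* [xget] returns some greatest element [b], equal to [a] by antisymmetry; the default 0 is excluded
   by [a] itself. *)
case: xgetP => [b _ [Ab ub]|/(_ a)[]//].
by apply/eqP; rewrite eq_le ua // ub.
Qed.

(** Splits off the part constant in [u], so that maximizing over [u] becomes maximizing a linear
    functional. *)
Lemma hdotE {R : realType} {n m : nat}
    (f : 'cV[R]_n -> 'cV[R]_n) (g : 'cV[R]_n -> 'M[R]_(n, m))
    (h : 'cV[R]_n -> R) x u :
  hdot f g h x u =
    dot (gradient h x) (f x) + dot ((gradient h x)^T *m g x)^T u.
Proof. by rewrite /hdot /dot trmxK mxE. Qed.

Lemma hdot_vertex_max {R : realType} {n m : nat}
    (f : 'cV[R]_n -> 'cV[R]_n) (g : 'cV[R]_n -> 'M[R]_(n, m))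
    (U : set 'cV[R]_m) (h : 'cV[R]_n -> R) x :
  is_polytope U -> U !=set0 ->
  exists2 v, vertices U v & forall u, U u -> hdot f g h x u <= hdot f g h x v.
Proof.
move=> [k [p ->]] U0.
have [v Vv vmax] := convex_hull_vertex_max p ((gradient h x)^T *m g x)^T U0.
by exists v => // u Uu; rewrite !hdotE lerD2l vmax.
Qed.

Theorem theorem10 (R : realType) (n m : nat)
    (f : 'cV[R]_n -> 'cV[R]_n) (g : 'cV[R]_n -> 'M[R]_(n, m))
    (U : set 'cV[R]_m) (hU : is_polytope U) (hU0 : U !=set0)
    (hUc : compact U)
    (h : 'cV[R]_n -> R) (hh : continuously_differentiable h)
    (D : set 'cV[R]_n) (hD : is_box D)
    (hCD : [set x | 0 <= h x] `<=` D)
    (alpha : R) (halpha : 0 < alpha) :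
  control_barrier_function f g U alpha D h <->
  (forall x, D x -> 0 <= barrier_fun f g U alpha h x \/ h x < 0).
Proof.
(* The supremum over [U] and the maximum over the vertices are attained at the same vertex [v], so
   the two inequalities differ only by moving [alpha * h x] across. *)
have key x : ((- (alpha * h x))%:E <=
    ereal_sup [set (hdot f g h x u)%:E | u in U])%E <->
    0 <= barrier_fun f g U alpha h x.
  have [v Vv vmax] := hdot_vertex_max f g U h x hU hU0.
  have supE : ereal_sup [set (hdot f g h x u)%:E | u in U] =
      (hdot f g h x v)%:E.
    apply/eqP; rewrite eq_le; apply/andP; split.
      by apply: ge_ereal_sup => _ [u Uu <-]; rewrite lee_fin vmax.
    by apply: ereal_sup_ubound; exists v => //; exact: vertices_sub.
  have maxE : set_max [set hdot f g h x u | u in vertices U] = hdot f g h x v.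
    apply: set_max_eq; first by exists v.
    by move=> _ [u /vertices_sub Uu <-]; exact: vmax.
  by rewrite supE lee_fin /barrier_fun maxE -lerBlDr sub0r.
split=> [[_ cbf] x Dx|B].
  have [h0|] := leP 0 (h x); last by right.
  by left; apply/key; exact: cbf.
split=> // x Dx h0; apply/key.
by have [//|] := B x Dx; rewrite ltNge h0.
Qed.
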